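(* Let $(X,\mathcal T)$ be a topological space. The following are equivalent: (1) $(X,\mathcal T)$ is normal in the topological sense (any two disjoint closed sets have disjoint open neighbourhoods); (2) the approach space $(X,\delta_{\mathcal T})$ is normal in the approach sense defined in the context.
   Context: A distance on a set $X$ is a function $\delta:X\times 2^X\to[0,\infty]$ such that for all $x\in X$, $A,B\subseteq X$, $\varepsilon\in[0,\infty]$: (D1) $\delta(x,\{x\})=0$; (D2) $\delta(x,\emptyset)=\infty$; (D3) $\delta(x,A\cup B)=\min\{\delta(x,A),\delta(x,B)\}$; (D4) $\delta(x,A)\le\delta(x,A^{(\varepsilon)})+\varepsilon$, where $A^{(\varepsilon)}=\{x\in X\mid\delta(x,A)\le\varepsilon\}$. The pair $(X,\delta)$ is an approach space. For a topology $\mathcal T$ on $X$, the associated distance is $\delta_{\mathcal T}(x,A)=0$ if $x\in\mathrm{cl}\,A$ and $\delta_{\mathcal T}(x,A)=\infty$ otherwise. For a real $\gamma>0$, sets $A,B\subseteq X$ are $\gamma$-separated if $A^{(\alpha)}\cap B^{(\beta)}=\emptyset$ whenever $\alpha\ge0$, $\beta\ge0$ and $\alpha+\beta<\gamma$. A contractive scale is a map $F:\mathbb Q\to 2^X$ with $\bigcup_{q\in\mathbb Q}F(q)=X$ and $\bigcap_{q\in\mathbb Q}F(q)=\emptyset$ such that for all rationals $r<s$ the sets $F(r)$ and $X\setminus F(s)$ are $(s-r)$-separated. $(X,\delta)$ is normal (in the approach sense) if for all $A,B\subseteq X$ and all real $\gamma>0$ with $A$ and $B$ $\gamma$-separated,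 there exists a contractive scale $F$ such that (i) $F(q)=\emptyset$ for all rational $q<0$; (ii) $A\subseteq\bigcap_{q\in\mathbb Q,\,q\ge0}F(q)$; (iii) $B\cap\bigcup_{r\in\mathbb Q\cap\,]0,\gamma]}F(r)=\emptyset$. *)

(* Defs.v *)
From HB Require Import structures.
From mathcomp Require Import all_boot all_order all_algebra.
From mathcomp Require Import all_classical all_reals all_analysis.
Set Implicit Arguments.
Unset Strict Implicit.
Unset Printing Implicit Defensive.
Import Order.TTheory GRing.Theory Num.Theory.
Local Open Scope classical_set_scope.
Local Open Scope ring_scope.
Local Open Scope ereal_scope.

Definition enlarge (R : realType) (X : Type) (d : X -> set X -> \bar R)
  (A : set X) (e : \bar R) : set X := [set x | d x A <= e].

(* The values lie in [0, +oo] by [dist_ge0]; a pair of a type [X] and an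
   element of [distance R X] is an approach space. *)
Record distance (R : realType) (X : Type) := Distance {
  dist :> X -> set X -> \bar R;
  dist_ge0 : forall x A, 0 <= dist x A;
  dist_set1 : forall x, dist x [set x] = 0;
  dist_set0 : forall x, dist x set0 = +oo;
  dist_setU : forall x A B,
    dist x (A `|` B) = Order.min (dist x A) (dist x B);
  dist_enlarge : forall x A (e : \bar R), 0 <= e ->
    dist x A <= dist x (enlarge dist A e) + e }.

Section approach_normality.
Context {R : realType} {X : Type}.
Variable d : distance R X.

Definition separated_by (g : R) (A B : set X) : Prop :=
  forall a b : R, (0 <= a)%R -> (0 <= b)%R -> (a + b < g)%R ->
    enlarge d A a%:E `&` enlarge d B b%:E = set0.

Definition contractive_scale (F : rat -> set X) : Prop :=
  [/\ \bigcup_(q in [set: rat]) F q = [set: X],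
      \bigcap_(q in [set: rat]) F q = set0
    & forall r s : rat, (r < s)%R ->
        separated_by (ratr (s - r)%R) (F r) (~` F s)].

Definition approach_normal : Prop :=
  forall (A B : set X) (g : R), (0 < g)%R -> separated_by g A B ->
  exists F : rat -> set X, [/\ contractive_scale F,
    forall q : rat, (q < 0)%R -> F q = set0,
    A `<=` \bigcap_(q in [set q : rat | (0 <= q)%R]) F q
  & B `&` \bigcup_(r in [set r : rat | (0 < r)%R /\ (ratr r <= g)%R]) F r
      = set0].

End approach_normality.

Section topological_distance.
Variables (R : realType) (T : topologicalType).

Definition topo_dist (x : T) (A : set T) : \bar R :=
  if x \in closure A then 0 else +oo.

Let topo_dist_ge0 x A : 0 <= topo_dist x A.
Proof. by rewrite /topo_dist; case: ifP. Qed.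

Let topo_dist_set1 x : topo_dist x [set x] = 0.
Proof. by rewrite /topo_dist mem_set//; exact: subset_closure. Qed.

Let topo_dist_set0 x : topo_dist x set0 = +oo.
Proof. by rewrite /topo_dist closure0 in_set0. Qed.

Let topo_dist_setU x A B :
  topo_dist x (A `|` B) = Order.min (topo_dist x A) (topo_dist x B).
Proof.
rewrite /topo_dist closureU in_setU.
by do 2 case: (x \in _) => /=; rewrite ?minxx ?miney ?minye.
Qed.

Let topo_dist_enlarge x A (e : \bar R) : 0 <= e ->
  topo_dist x A <= topo_dist x (enlarge topo_dist A e) + e.
Proof.
move=> e0; have [->|ey] := eqVneq e +oo.
  by rewrite addey ?leey// -ltNye (lt_le_trans _ (topo_dist_ge0 _ _)).
have -> : enlarge topo_dist A e = closure A.
  apply/seteqP; split => y; rewrite /enlarge /topo_dist /=.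
    by case: ifPn => [/set_mem//|_]; rewrite leye_eq (negbTE ey).
  by move=> yA; rewrite mem_set.
rewrite /topo_dist -(proj1 (closure_id _) (@closed_closure _ A)).
by case: ifP => _; rewrite ?add0e ?addye// -ltNye (lt_le_trans _ e0).
Qed.

Definition topo_distance : distance R T :=
  Distance topo_dist_ge0 topo_dist_set1 topo_dist_set0 topo_dist_setU
    topo_dist_enlarge.

End topological_distance.

Definition topologically_normal (T : topologicalType) : Prop :=
  forall A B : set T, closed A -> closed B -> A `&` B = set0 ->
  exists U V : set T,
    [/\ open U, open V, A `<=` U, B `<=` V & U `&` V = set0].

(* Agreement with the library's notion, which is phrased with closed
   neighbourhoods. The type [R] is only used by the library's proof. *)
Lemma topologically_normalE (R : realType) (T : topologicalType) :
  topologically_normal T <-> normal_space T.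
Proof. by symmetry; exact: (@normal_openP R T). Qed.

(* Main.v *)
Require Import Defs.
From mathcomp Require Import all_boot all_order all_algebra.
From mathcomp Require Import all_classical all_reals all_analysis.
From mathcomp Require Import lra.

(** The distance of a topology only takes the values [0] and [+oo], so every
    finite enlargement of a set [A] is the closure of [A], and being
    [g]-separated means having disjoint closures, whatever [g > 0] is
    ([separated_by_topoP]). Read this way, the approach normality of
    [topo_distance R T] is a form of Urysohn's lemma.

    If [T] is normal and the closures of [A] and [B] are disjoint, Urysohn's
    lemma gives a continuous [f] with values in [[0, 1]] that is [0] on [A] and
    [1] on [B]. The sublevel sets of a continuous real function form a
    contractive scale ([contractive_scale_sublevel]), and those of [2 * g * f]
    satisfy the three boundary conditions.

    Conversely, let [F] be a contractive scale given by approach normality for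
    disjoint closed sets [A] and [B] with [g = 1]. The levels [0 < 1/2 < 1]
    suffice: the closure of [F 0] lies in the interior of [F (1/2)], whose
    closure lies in the interior of [F 1]. As [A] is contained in [F 0] and [B]
    avoids [F 1], the interior of [F (1/2)] and the exterior of [F (1/2)]
    separate [A] from [B]. *)

Set Implicit Arguments.
Unset Strict Implicit.
Unset Printing Implicit Defensive.
Import Order.TTheory GRing.Theory Num.Theory.
Import numFieldNormedType.Exports.
Local Open Scope classical_set_scope.
Local Open Scope ring_scope.

Section topological_distance_separation.
Context {R : realType} {T : topologicalType}.
Implicit Types (A B : set T) (f : T -> R).

Lemma enlarge_topo A (a : R) : 0 <= a ->
  enlarge (topo_distance R T) A a%:E = closure A.
Proof.
move=> a0; apply/seteqP; split => x; rewrite /enlarge /= /topo_dist.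
  by case: ifPn => [/set_mem//|_]; rewrite leye_eq.
by move=> xA; rewrite mem_set.
Qed.

Lemma separated_by_topoP (g : R) A B : 0 < g ->
  separated_by (topo_distance R T) g A B <-> closure A `&` closure B = set0.
Proof.
move=> g0; split=> [/(_ 0 0)|AB a b a0 b0 _]; last by rewrite !enlarge_topo.
by rewrite addr0 !enlarge_topo//; exact.
Qed.

(** For [r < s], the closed sets [f <= r] and [s <= f] are disjoint, and they
    contain the [r]-th level and the complement of the [s]-th one. The levels
    exhaust [T] and have no common point because the reals are archimedean. *)
Lemma contractive_scale_sublevel f : continuous f ->
  contractive_scale (topo_distance R T)
    (fun q : rat => [set x | f x <= ratr q]).
Proof.
move=> cf; split.
- apply/seteqP; split => // x _.
  exists (Num.truncn (f x)).+1%:R => //=.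
  by rewrite ratr_nat ltW// truncnS_gt.
- apply/seteqP; split => // x /(_ (- (Num.truncn (- f x)).+1%:R) I) /=.
  rewrite rmorphN /= ratr_nat lerNr leNgt.
  by rewrite truncnS_gt.
- move=> r s rs; apply/separated_by_topoP; first by rewrite ltr0q subr_gt0.
  have cle : closed [set x | f x <= ratr r].
    by apply: (@preimage_closed _ _ f [set y | y <= ratr r]);
      [move=> x _; exact: cf|exact: closed_le].
  have cge : closed [set x | ratr s <= f x].
    by apply: (@preimage_closed _ _ f [set y | ratr s <= y]);
      [move=> x _; exact: cf|exact: closed_ge].
  have sub : ~` [set x | f x <= ratr s] `<=` [set x | ratr s <= f x].
    by move=> x /= /negP; rewrite -ltNge => /ltW.
  apply/seteqP; split => // x [].
  rewrite -(proj1 (closure_id _) cle) => /= fr.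
  move=> /(closureS sub); rewrite -(proj1 (closure_id _) cge) => /= fs.
  by move: (le_trans fs fr); rewrite ler_rat leNgt rs.
Qed.

End topological_distance_separation.

Lemma topologically_normal_approach_normal (R : realType)
    (T : topologicalType) :
  topologically_normal T -> approach_normal (topo_distance R T).
Proof.
move=> /(topologically_normalE R) nT A B g g0 /(separated_by_topoP _ _ g0) AB.
have /(@uniform_separatorP _ R)[f [cf f01 f0 f1]] :=
  normal_uniform_separator nT (@closed_closure _ A) (@closed_closure _ B) AB.
have fge0 x : 0 <= f x.
  by have /= := f01 _ (imageT f x); rewrite in_itv /= => /andP[].
(* The factor 2 is there because the level at [g] itself must avoid [B],
   while [g * f] takes the value [g] on [B]. *)
pose h x := 2 * g * f x.
have hge0 x : 0 <= h x by rewrite /h !mulr_ge0// ltW.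
have ch : continuous h.
  by move=> x; apply: cvgM; [exact: cvg_cst|exact: cf].
exists (fun q : rat => [set x | h x <= ratr q]); split.
- exact: contractive_scale_sublevel.
- move=> q q0; apply/seteqP; split => // x /= hq.
  by move: (le_trans (hge0 x) hq); rewrite ler0q leNgt q0.
- move=> x Ax q /= q0.
  have -> : h x = 0.
    by rewrite /h (f0 (f x)) ?mulr0//; exists x => //; exact: subset_closure.
  by rewrite ler0q.
- apply/seteqP; split => // x [Bx [r /= [_ rg]]].
  have -> : h x = 2 * g.
    by rewrite /h (f1 (f x)) ?mulr1//; exists x => //; exact: subset_closure.
  by move=> /le_trans/(_ rg) hg; lra.
Qed.

Lemma approach_normal_topologically_normal (R : realType)
    (T : topologicalType) :
  approach_normal (topo_distance R T) -> topologically_normal T.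
Proof.
move=> nX A B cA cB AB.
have sAB : separated_by (topo_distance R T) 1 A B.
  apply/separated_by_topoP => //.
  by rewrite -(proj1 (closure_id _) cA) -(proj1 (closure_id _) cB).
have [F [[_ _ Fsep] _ AF BF]] := nX A B 1 ltr01 sAB.
have disj (r s : rat) : r < s -> closure (F r) `&` closure (~` F s) = set0.
  move=> rs; apply/(@separated_by_topoP R _ (ratr (s - r))); last exact: Fsep.
  by rewrite ltr0q subr_gt0.
have h0 : (0 : rat) < 2^-1 by [].
have h1 : (2^-1 : rat) < 1 by [].
have BF1 : B `<=` ~` F 1.
  move=> x Bx F1x; suff : set0 x by [].
  by rewrite -BF; split => //; exists 1 => //=; rewrite rmorph1.
exists (~` closure (~` F 2^-1)), (~` closure (F 2^-1)); split.
- exact/closed_openC/closed_closure.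
- exact/closed_openC/closed_closure.
- move=> x Ax nx; suff : set0 x by [].
  by rewrite -(disj _ _ h0); split => //; apply/subset_closure/(AF _ Ax) => /=.
- move=> x Bx nx; suff : set0 x by [].
  by rewrite -(disj _ _ h1); split => //; exact/subset_closure/BF1.
- apply/seteqP; split => // x [nF nFC].
  have [Fx|Fx] := pselect (F 2^-1 x).
    exact/nFC/subset_closure.
  exact/nF/subset_closure.
Qed.

Theorem proposition3p10 (R : realType) (T : topologicalType) :
  topologically_normal T <-> approach_normal (topo_distance R T).
Proof.
split.
- exact: topologically_normal_approach_normal.
- exact: approach_normal_topologically_normal.
Qed.
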